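(* Let $p$ and $q$ be prime numbers with $p<q$ and $p \equiv q \equiv 3 \pmod 4$. Then $$l(\sqrt{pq}) \equiv 1 + \left(\frac{q}{p}\right) \pmod 4,$$ where $\left(\frac{q}{p}\right)$ is the Legendre symbol.
   Context: For a real quadratic irrational number $\alpha$, $l(\alpha)$ denotes the minimal period length of its (eventually periodic) usual (regular) continued fraction expansion $a_0+\cfrac{1}{a_1+\cfrac{1}{a_2+\cdots}}$ with $a_0\in\mathbb{Z}$ and $a_i$ positive integers for $i\ge 1$. *)

(* Defs.v *)
From mathcomp Require Import all_boot all_order all_algebra.
From mathcomp Require Import boolp reals.

Set Implicit Arguments.
Unset Strict Implicit.
Unset Printing Implicit Defensive.

Import Order.TTheory GRing.Theory Num.Theory.
Local Open Scope ring_scope.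

(* Complete quotients x_0 = x, x_(n+1) = 1 / (x_n - floor x_n). *)
Fixpoint cf_quot (R : realType) (x : R) (n : nat) : R :=
  if n is m.+1 then (cf_quot x m - (Num.floor (cf_quot x m))%:~R)^-1 else x.

(* Partial quotients a_n of x. For irrational x the expansion never stops; for
   rational x, x_n and hence a_n are 0 past the last partial quotient, by the
   convention 0^-1 = 0. *)
Definition cf_digit (R : realType) (x : R) (n : nat) : int :=
  Num.floor (cf_quot x n).

Lemma cf_quotE (R : realType) (x : R) (n : nat) :
  cf_quot x n = (cf_digit x n)%:~R + (cf_quot x n.+1)^-1.
Proof. by rewrite /cf_digit /= invrK addrC subrK. Qed.

Lemma cf_digit_gt0 (R : realType) (x : R) (n : nat) :
  cf_quot x n \isn't a Num.int -> 0 < cf_digit x n.+1.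
Proof.
move=> xn; rewrite gtz0_ge1 /cf_digit floor_ge_int /=.
have fle := floor_le (cf_quot x n).
have flt := floorD1_gt (cf_quot x n).
have d_gt0 : 0 < cf_quot x n - (Num.floor (cf_quot x n))%:~R.
  rewrite subr_gt0 lt_neqAle fle andbT.
  by apply: contra xn => /eqP <-; exact: intr_int.
by rewrite invf_ge1 // ltW // ltrBlDr -[1]/(1%:~R) -intrD addrC.
Qed.

Definition eventual_period (T : Type) (a : nat -> T) (l : nat) : Prop :=
  (0 < l)%N /\ exists N, forall n, (N <= n)%N -> a (n + l)%N = a n.

Lemma ex_eventual_period (T : Type) (a : nat -> T) :
  (exists l, eventual_period a l) -> exists l, `[< eventual_period a l >].
Proof. by move=> [l al]; exists l; apply/asboolP. Qed.

(* Equals 0 when [a] is not eventually periodic. *)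
Definition min_period (T : Type) (a : nat -> T) : nat :=
  match pselect (exists l, eventual_period a l) with
  | left h => ex_minn (ex_eventual_period h)
  | right _ => 0
  end.

Lemma min_periodP (T : Type) (a : nat -> T) :
  (exists l, eventual_period a l) ->
  eventual_period a (min_period a) /\
  forall l, eventual_period a l -> (min_period a <= l)%N.
Proof.
rewrite /min_period => h; case: pselect => // h'.
by case: ex_minnP => m /asboolP am le_m; split=> // l /asboolP /le_m.
Qed.

Definition cf_period (R : realType) (x : R) : nat := min_period (cf_digit x).

(* Meant for p an odd prime. *)
Definition legendre (a : int) (p : nat) : int :=
  if (p %| a)%Z then 0
  else if [exists x : 'I_p, (x%:Z ^+ 2 == a %[mod p])%Z] then 1 else -1.

(* Main.v *)
Require Import Defs.
From mathcomp Require Import all_boot all_order all_algebra.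
From mathcomp Require Import zify ring lra.
From mathcomp Require Import boolp reals.

Import Order.TTheory GRing.Theory Num.Theory.
Local Open Scope ring_scope.

(* Let [n = p q] and [m = floor (sqrt n)]. From [m + sqrt n] on, the complete quotients
   [(P + sqrt n) / Q] of [sqrt n] form a purely periodic orbit of the map
   [(P, Q) |-> (P', Q')], [P' = a Q - P], [Q' = (n - P' ^ 2) / Q]. This map is a product of two
   involutions, [(P, Q) |-> (P', Q)] and [(P, Q) |-> (P, (n - P ^ 2) / Q)], and the first one
   fixes the initial state [(m, 1)], so it reverses the whole orbit. If the period is odd, the
   second involution fixes a state in the middle, whence [n = P ^ 2 + Q ^ 2], which is impossible
   as [p = 3 mod 4]. If the period is [2 k], the first involution fixes the [k]-th state, whence
   [2 P = a Q]; by the norm equation [x ^ 2 - n y ^ 2 = (-1) ^ k Q] of the convergents, [Q] is odd,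
   so [Q] divides [P] and [n] and is less than [sqrt n], and [Q = p]. Then
   [p x' ^ 2 - q y ^ 2 = (-1) ^ k] gives [(q / p) = - (-1) ^ k]. *)

(** * The continued fraction of a square root *)

Section ReducedStates.

Variables (n m : int).
Hypothesis n_bounds : m ^+ 2 < n < (m + 1) ^+ 2.

(* The state [(P, Q)] stands for [(P + sqrt n) / Q]. *)
Definition digit (s : int * int) : int := ((s.1 + m) %/ s.2)%Z.

Definition reflectP (s : int * int) : int * int := (digit s * s.2 - s.1, s.2).

Definition reflectQ (s : int * int) : int * int :=
  (s.1, ((n - s.1 ^+ 2) %/ s.2)%Z).

Definition step (s : int * int) : int * int := reflectQ (reflectP s).

(* Says that [(P + sqrt n) / Q > 1] has its conjugate in [(-1, 0)]; as [P] and [Q] are integers,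
   [sqrt n] can be replaced by its floor. *)
Definition reduced (s : int * int) : bool :=
  [&& s.1 <= m, m < s.1 + s.2, s.2 <= m + s.1 & (s.2 %| n - s.1 ^+ 2)%Z].

Lemma reducedP (P Q : int) : reflect
  [/\ P <= m, m < P + Q, Q <= m + P & exists Q', n - P ^+ 2 = Q' * Q]
  (reduced (P, Q)).
Proof.
by apply: (iffP and4P) => -[? ? ? /dvdzP ?]; split=> //; apply/dvdzP.
Qed.

Lemma reduced_gt0 (s : int * int) : reduced s -> 0 < s.1 /\ 0 < s.2.
Proof. by case: s => P Q /reducedP[? ? ? _]; split=> /=; lia. Qed.

Lemma digit_bounds (s : int * int) : reduced s ->
  digit s * s.2 <= s.1 + m < (digit s + 1) * s.2.
Proof.
move=> /reduced_gt0[_ Q0]; rewrite /digit.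
have := divz_eq (s.1 + m) s.2.
have := modz_ge0 (s.1 + m) (lt0r_neq0 Q0); have := ltz_pmod (s.1 + m) Q0.
nia.
Qed.

Lemma digit_unique (s : int * int) (a : int) :
  0 < s.2 -> a * s.2 <= s.1 + m < (a + 1) * s.2 -> digit s = a.
Proof.
move=> Q0; rewrite /digit.
have := divz_eq (s.1 + m) s.2.
have := modz_ge0 (s.1 + m) (lt0r_neq0 Q0); have := ltz_pmod (s.1 + m) Q0.
nia.
Qed.

Lemma reduced_reflectP (s : int * int) : reduced s -> reduced (reflectP s).
Proof.
move=> red_s; have := digit_bounds s red_s.
case: s red_s => P Q; rewrite /reflectP /=; set a := digit _.
move=> /reducedP[PM MPQ QM [Q' nE]] aB.
have a1 : 1 <= a by nia.
apply/reducedP; split; [lia | lia | nia |].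
exists (Q' + 2 * a * P - a ^+ 2 * Q).
by have -> : n = Q' * Q + P ^+ 2 by [rewrite -nE subrK]; ring.
Qed.

Lemma reflectPK (s : int * int) : reduced s -> reflectP (reflectP s) = s.
Proof.
move=> red_s; have := digit_bounds s red_s; have [P0 Q0] := reduced_gt0 s red_s.
case: s red_s P0 Q0 => P Q /= /reducedP[PM MPQ QM _] P0 Q0 aB.
(* Since [0 <= m - P < Q], the number [a * Q - P + m] lies in [[a * Q, (a + 1) * Q)]. *)
have dE : digit (reflectP (P, Q)) = digit (P, Q).
  by apply: digit_unique => //; rewrite /reflectP /=; lia.
by rewrite {1}/reflectP dE /reflectP /=; congr pair; ring.
Qed.

(** [Q * Q' = n - P ^ 2] lies strictly between [(m - P) (m + P)] and [(m + 1 - P) (m + 1 + P)], so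
    each bound on [Q] yields the opposite bound on [Q']. *)
Lemma reduced_reflectQ (s : int * int) : reduced s -> reduced (reflectQ s).
Proof.
case: s => P Q red_s; have [/= P0 Q0] := reduced_gt0 _ red_s.
case/reducedP: red_s => PM MPQ QM [Q' nE].
rewrite /reflectQ /= nE mulzK ?gt_eqF //.
apply/reducedP; split; [by [] | nia | nia |].
by exists Q; rewrite mulrC.
Qed.

Lemma reflectQK (s : int * int) : reduced s -> reflectQ (reflectQ s) = s.
Proof.
move=> red_s; have [/= _ Q'0] := reduced_gt0 _ (reduced_reflectQ s red_s).
case: s red_s Q'0 => P Q red_s; have [/= P0 Q0] := reduced_gt0 _ red_s.
case/reducedP: red_s => PM MPQ QM [Q' nE].
rewrite /reflectQ /= nE mulzK ?gt_eqF // => Q'0.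
by rewrite [Q' * Q]mulrC mulzK ?gt_eqF.
Qed.

Lemma reduced_step (s : int * int) : reduced s -> reduced (step s).
Proof. by move=> red_s; apply/reduced_reflectQ/reduced_reflectP. Qed.

Lemma reduced_iter (s : int * int) (j : nat) : reduced s -> reduced (iter j step s).
Proof. by move=> red_s; elim: j => //= j; apply: reduced_step. Qed.

Lemma step_inj : {in reduced &, injective step}.
Proof.
move=> s t red_s red_t /(congr1 reflectQ).
by rewrite !reflectQK ?reduced_reflectP // => /(congr1 reflectP); rewrite !reflectPK.
Qed.

Lemma iter_step_inj (j : nat) : {in reduced &, injective (iter j step)}.
Proof.
elim: j => // j IHj s t red_s red_t /= /step_inj eq_st.
by apply: IHj => //; apply: eq_st; apply: reduced_iter.
Qed.

(** Pigeonhole: reduced states lie in the box [0 < P <= m], [0 < Q <= 2 m]. Injectivity of [step]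
    turns a repetition into a return to [s]. *)
Lemma iter_step_periodic (s : int * int) : reduced s ->
  exists2 l, (0 < l)%N & iter l step s = s.
Proof.
move=> red_s.
pose f (i : 'I_(`|m|.+1 * (2 * `|m|).+1).+1) : 'I_`|m|.+1 * 'I_(2 * `|m|).+1 :=
  (inord `|(iter i step s).1|, inord `|(iter i step s).2|).
have /injectivePn[i [j ij eq_f]] : ~~ injectiveb f.
  by apply/injectiveP => /leq_card; rewrite card_prod !card_ord ltnn.
have eq_iter : iter i step s = iter j step s.
  have := reduced_iter s i red_s; have := reduced_iter s j red_s.
  case: eq_f; case: (iter i step s) => P Q; case: (iter j step s) => P' Q' /=.
  move=> eP eQ red' red; have [/= ? ?] := reduced_gt0 _ red.
  have [/= ? ?] := reduced_gt0 _ red'.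
  case/reducedP: red => *; case/reducedP: red' => *.
  move: (congr1 val eP) (congr1 val eQ); rewrite /= !inordK; try lia.
  by move=> ? ?; congr pair; lia.
clear eq_f; wlog ltij : i j ij eq_iter / (i < j)%N.
  case: (ltngtP i j) => [lt|gt|/val_inj eij] H; first exact: (H i j).
  - by apply: (H j i); rewrite // eq_sym.
  - by rewrite eij eqxx in ij.
exists (j - i)%N; first by rewrite subn_gt0.
apply: (iter_step_inj i) => //; first exact: reduced_iter.
by rewrite -iterD subnKC 1?ltnW.
Qed.

(* [step] composes the reflections [reflectP] and [reflectQ], so a reflection conjugates it to
   its inverse. *)
Lemma reflectP_iter (s : int * int) (i j : nat) : reduced s -> reflectP s = s ->
  iter (i + j) step s = s -> reflectP (iter i step s) = iter j step s.
Proof.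
move=> red_s fix_s; elim: i j => [|i IHi] j eq_s.
  by rewrite add0n in eq_s; rewrite /= fix_s eq_s.
have red_i := reduced_iter s i red_s.
have /= eq_i : reflectP (iter i step s) = iter j.+1 step s.
  by apply: IHi; rewrite addnS -addSn.
by rewrite {1}/step eq_i reflectQK ?reflectPK ?reduced_reflectP ?reduced_iter.
Qed.

(** * The orbit of [m + sqrt n] *)

Definition principal : int * int := (m, 1).

Lemma reduced_principal : 0 < m -> reduced principal.
Proof.
move=> m0; apply/reducedP; split; [lia.. |].
by exists (n - m ^+ 2); rewrite mulr1.
Qed.

Lemma digit_principal : digit principal = 2 * m.
Proof. by rewrite /digit /= divz1 mulr2n mulrDl mul1r. Qed.

Lemma reflectP_principal : reflectP principal = principal.
Proof. by rewrite /reflectP digit_principal /=; congr pair; ring. Qed.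

(* [(x, y)] and [(x', y')] are numerators and denominators of consecutive convergents. *)
Lemma convergents (j : nat) : 0 < m -> exists x y x' y' Q' : int,
  let: (P, Q) := iter j step principal in
  [/\ n - P ^+ 2 = Q' * Q, x ^+ 2 - n * y ^+ 2 = (-1) ^+ j * Q,
      x * x' - n * y * y' = - (-1) ^+ j * P &
      x' ^+ 2 - n * y' ^+ 2 = - (-1) ^+ j * Q'].
Proof.
move=> m0; elim: j => [|j [x [y [x' [y' [Q']]]]]].
  (* The fictitious predecessor [(- m, 1)] makes the first digit [2 m] lead to [(m, 1)], the first
     convergent of [sqrt n]. *)
  by exists 1, 0, (- m), 1, (n - m ^+ 2); split; rewrite /= ?expr0; ring.
rewrite /= [(-1) ^+ _.+1]exprS; have := reduced_iter _ j (reduced_principal m0).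
case: (iter j step _) => P Q red_s; rewrite /step /reflectP /reflectQ /=.
set a := digit _ => -[nE e1 e2 e3].
exists (a * x + x'), (a * y + y'), x, y, Q.
have [/= _ Q0] := reduced_gt0 _ red_s.
have nE1 : n - (a * Q - P) ^+ 2 = (Q' + 2 * a * P - a ^+ 2 * Q) * Q.
  by have -> : n = Q' * Q + P ^+ 2 by [rewrite -nE subrK]; ring.
rewrite nE1 mulzK ?gt_eqF //; split; first by rewrite mulrC.
- transitivity (a ^+ 2 * (x ^+ 2 - n * y ^+ 2) + 2 * a * (x * x' - n * y * y')
                + (x' ^+ 2 - n * y' ^+ 2)); first by ring.
  rewrite e1 e2 e3; ring.
- transitivity (a * (x ^+ 2 - n * y ^+ 2) + (x * x' - n * y * y')); first by ring.
  by rewrite e1 e2; ring.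
- by rewrite e1; ring.
Qed.

Lemma odd_period (k : nat) : 0 < m -> iter (k + k.+1) step principal = principal ->
  exists P Q : int, n = P ^+ 2 + Q ^+ 2.
Proof.
move=> m0 /(reflectP_iter _ _ _ (reduced_principal m0) reflectP_principal) eq_k.
have : reduced (iter k.+1 step principal) by apply/reduced_iter/reduced_principal.
(* State [k.+1] is [reflectP] of state [k], and applying [reflectQ] to that is by definition one
   [step] from state [k]. *)
have : reflectQ (iter k.+1 step principal) = iter k.+1 step principal.
  by rewrite -{1}eq_k.
case: (iter k.+1 step _) => P Q [eQ] red_s; have [/= _ Q0] := reduced_gt0 _ red_s.
case/reducedP: red_s eQ => _ _ _ [Q' nE]; rewrite nE mulzK ?gt_eqF // => eQ.
by exists P, Q; rewrite addrC -[n](subrK (P ^+ 2)) nE eQ.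
Qed.

Lemma even_period (k : nat) : 0 < m -> iter (k + k) step principal = principal ->
  iter k step principal <> principal ->
  exists P Q Q' a x y : int, [/\ 0 < P, P <= m & 1 < Q] /\
    [/\ n - P ^+ 2 = Q' * Q, 2 * P = a * Q & x ^+ 2 - n * y ^+ 2 = (-1) ^+ k * Q].
Proof.
move=> m0 /(reflectP_iter _ _ _ (reduced_principal m0) reflectP_principal).
have [x [y [x' [y' [Q' ]]]]] := convergents k m0.
have := reduced_iter _ k (reduced_principal m0).
case: (iter k step _) => P Q red_s [nE e1 _ _] {x' y'}.
rewrite /reflectP /=; set a := digit _ => -[aE] neq_s.
have [/= P0 Q0] := reduced_gt0 _ red_s; case/reducedP: red_s => PM MPQ QM _.
exists P, Q, Q', a, x, y; split; split=> //; last by lia.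
have Q1 : Q <> 1.
  by move=> Q1; apply: neq_s; rewrite /principal; congr pair; lia.
lia.
Qed.

(* Descent: if [sqrt n = d / c], then also [sqrt n = (c n - d m) / (d - c m)]. *)
Lemma nonsquare (c d : int) : c ^+ 2 * n = d ^+ 2 -> c = 0.
Proof.
wlog [c0 d0] : c d / 0 <= c /\ 0 <= d.
  move=> H eq_cd; have : `|c| = 0; last by lia.
  by apply: (H _ `|d|); rewrite ?normr_ge0 // -!normrX !ger0_norm ?sqr_ge0.
move: c0; have [k le_ck] := ubnP `|c|%N; elim: k c d d0 le_ck => // k IHk c d d0.
move=> le_ck c0 eq_cd.
case: (ltrgtP c 0) => [|c_gt0|]; [lia | | by []].
have m_ge0 : 0 <= m by nia.
have ltd : c * m < d by nia.
have ltd' : d < c * (m + 1) by nia.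
suff : d - c * m = 0 by lia.
apply: (IHk _ (c * n - d * m)); [nia | nia | lia |].
apply/eqP; rewrite -subr_eq0.
have -> : (d - c * m) ^+ 2 * n - (c * n - d * m) ^+ 2 = (d ^+ 2 - c ^+ 2 * n) * (n - m ^+ 2).
  by ring.
by rewrite eq_cd subrr mul0r.
Qed.

(** * From integer states to real complete quotients *)

Section CompleteQuotients.

Variables (R : realType) (r : R).
Hypotheses (r_ge0 : 0 <= r) (r_sqr : r ^+ 2 = n%:~R) (m_gt0 : 0 < m).

Definition quot (s : int * int) : R := (s.1%:~R + r) / s.2%:~R.

Lemma root_bounds : m%:~R < r < m%:~R + 1.
Proof.
have m0R : 0 <= m%:~R :> R by rewrite ler0z ltW.
have [] := andP n_bounds; rewrite -!(ltr_int R) -r_sqr !rmorphXn rmorphD /=.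
by rewrite !ltr_pXn2r ?nnegrE ?addr_ge0 // => -> ->.
Qed.

Lemma floor_root : Num.floor r = m.
Proof. by apply: floor_def; rewrite rmorphD /=; have := root_bounds; lra. Qed.

Lemma quot_gt1 (s : int * int) : reduced s -> 1 < quot s.
Proof.
move=> red_s; have [_ Q0] := reduced_gt0 _ red_s.
have /andP[mr _] := root_bounds; rewrite /quot ltr_pdivlMr ?ltr0z // mul1r.
case: s red_s Q0 => P Q /reducedP[_ _ + _] _ /=.
rewrite -(ler_int R) rmorphD /=; lra.
Qed.

Lemma floor_quot (s : int * int) : reduced s -> Num.floor (quot s) = digit s.
Proof.
move=> red_s; have [_ Q0] := reduced_gt0 _ red_s.
have /andP[mr rm] := root_bounds.
(* Between integers the strict upper bound gains 1, which leaves room for [r < m + 1] in place of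
   [m]. *)
have := digit_bounds _ red_s; rewrite -lezD1 -!(ler_int R) !(rmorphD, rmorphM) /=.
move=> /andP[lo hi].
apply: floor_def; rewrite /quot ler_pdivlMr ?ltr_pdivrMr ?ltr0z // rmorphD /=; lra.
Qed.

(** Rationalizing the denominator: [Q / (r - P) = (P + r) / Q'] for the reflected state, as
    [Q * Q' = (r - P) (r + P)]. *)
Lemma quot_step (s : int * int) : reduced s ->
  (quot s - (digit s)%:~R)^-1 = quot (step s).
Proof.
move=> red_s; have := reduced_reflectP _ red_s; have [_ Q0] := reduced_gt0 _ red_s.
have -> : quot s - (digit s)%:~R = (r - (reflectP s).1%:~R) / (reflectP s).2%:~R.
  rewrite /quot /reflectP /= rmorphB rmorphM /=; field.
  by rewrite intr_eq0 gt_eqF.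
rewrite /step; case: (reflectP s) => P Q {s red_s Q0} red_s.
have [/= P0 Q0] := reduced_gt0 _ red_s.
have [/= _] := reduced_gt0 _ (reduced_reflectQ _ red_s).
have /andP[mr _] := root_bounds.
case/reducedP: red_s => + _ _ [Q' nE]; rewrite -(ler_int R) => PM.
rewrite /quot /reflectQ /= nE mulzK ?gt_eqF // => Q'0.
have /(congr1 (fun z => z%:~R : R)) := nE.
rewrite rmorphB rmorphXn rmorphM /= -r_sqr => eQ.
have d0 : r - P%:~R != 0 by rewrite gt_eqF // subr_gt0; lra.
have Q'R : Q'%:~R != 0 :> R by rewrite intr_eq0 gt_eqF.
rewrite invf_div; apply/eqP; rewrite eqr_div //; apply/eqP.
by rewrite mulrC -eQ; ring.
Qed.

(** Equal quotients make [(Q' - Q) * r] an integer, so irrationality of [r] forces [Q = Q']. *)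
Lemma quot_inj : {in reduced &, injective quot}.
Proof.
move=> [P Q] [P' Q'] /reduced_gt0[/= _ Q0] /reduced_gt0[/= _ Q'0].
rewrite /quot /= => /eqP; rewrite eqr_div ?intr_eq0 ?(gt_eqF Q0) ?(gt_eqF Q'0) // => /eqP eq_q.
have eq_r : (Q' - Q)%:~R * r = (P' * Q - P * Q')%:~R.
  by rewrite !rmorphB !rmorphM /=; lra.
have /nonsquare eq_Q : (Q' - Q) ^+ 2 * n = (P' * Q - P * Q') ^+ 2.
  apply: (@intr_inj R).
  by rewrite rmorphM !rmorphXn /= -r_sqr -exprMn eq_r.
have eQ : Q' = Q by lia.
move: eq_r; rewrite eQ subrr mul0r => /esym/eqP; rewrite intr_eq0 => eP.
by congr pair; nia.
Qed.

(* Since [x - y = (y' - x') / (x' y')] for the next complete quotients [x', y' > 1], distances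
   strictly grow along equal digits. *)
Lemma quot_dist_lt (s t : int * int) : reduced s -> reduced t -> s <> t ->
  digit s = digit t -> `|quot s - quot t| < `|quot (step s) - quot (step t)|.
Proof.
move=> red_s red_t neq_st eq_d.
have sE : quot s = (digit s)%:~R + (quot (step s))^-1.
  by rewrite -quot_step // invrK addrC subrK.
have tE : quot t = (digit s)%:~R + (quot (step t))^-1.
  by rewrite eq_d -quot_step // invrK addrC subrK.
have x1 := quot_gt1 _ (reduced_step _ red_s).
have y1 := quot_gt1 _ (reduced_step _ red_t).
have st0 : 0 < `|quot s - quot t|.
  by rewrite normr_gt0 subr_eq0; apply/eqP => /(quot_inj _ _ red_s red_t).
have := sE; have := tE; move: (quot (step s)) (quot (step t)) x1 y1 => x y x1 y1 yE xE.
have -> : x - y = (quot s - quot t) * - (x * y).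
  by rewrite xE yE; field; rewrite !gt_eqF //; lra.
rewrite normrM ltr_pMr // normrN gtr0_norm; nra.
Qed.

(** Distinct states with equal digits would move strictly apart forever, yet both return after
    [L * L'] steps. *)
Lemma digits_inj (s t : int * int) : reduced s -> reduced t ->
  (forall j, digit (iter j step s) = digit (iter j step t)) -> s = t.
Proof.
move=> red_s red_t eq_d; apply: contrapT => neq_st.
have [L L0 sL] := iter_step_periodic _ red_s.
have [L' L'0 tL'] := iter_step_periodic _ red_t.
have dist_lt j : `|quot s - quot t| <
    `|quot (iter j.+1 step s) - quot (iter j.+1 step t)|.
  elim: j => [|j IHj]; first exact: quot_dist_lt (eq_d 0%N).
  apply: (lt_trans IHj); apply: (quot_dist_lt _ _ _ _ _ (eq_d j.+1)).
  - exact: reduced_iter.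
  - exact: reduced_iter.
  - by move=> /(iter_step_inj j.+1 _ _ red_s red_t).
have := dist_lt (L * L').-1; rewrite prednK ?muln_gt0 ?L0 //.
have -> : iter (L * L') step s = s by rewrite mulnC iterM iter_fix.
by rewrite iterM iter_fix // ltxx.
Qed.

(** Indices start at 1: [r] and [m + r] differ by an integer, so they agree only after the first
    digit is removed. *)
Lemma cf_quot_root (j : nat) : cf_quot r j.+1 = quot (iter j.+1 step principal).
Proof.
have red j' : reduced (iter j' step principal) by apply/reduced_iter/reduced_principal.
elim: j => [|j IHj].
  rewrite /= floor_root -quot_step ?reduced_principal // digit_principal.
  by congr (_^-1); rewrite /quot /= divr1 rmorphM /=; ring.
by rewrite [LHS]/= -/(cf_quot r j.+1) IHj floor_quot // quot_step.
Qed.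

Lemma cf_digit_root (j : nat) : cf_digit r j.+1 = digit (iter j.+1 step principal).
Proof.
by rewrite /cf_digit cf_quot_root floor_quot //; apply/reduced_iter/reduced_principal.
Qed.

(** Repeating digits identify two far states by [digits_inj], and injectivity of [step] carries the
    equality back to [principal]. *)
Lemma eventual_period_root (l : nat) : eventual_period (cf_digit r) l <->
  (0 < l)%N /\ iter l step principal = principal.
Proof.
have red j : reduced (iter j step principal) by apply/reduced_iter/reduced_principal.
split=> -[l0].
  case=> N eq_a; split=> //; apply: (iter_step_inj N.+1); [exact: red | exact: (red 0%N) |].
  rewrite -iterD; apply: digits_inj => // j.
  by rewrite -!iterD addnA addnS addSn -!cf_digit_root -addSn eq_a //; lia.
move=> eq_l; split=> //; exists 1%N => -[//|j] _.
by rewrite addSn !cf_digit_root -addSn iterD eq_l.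
Qed.

Lemma cf_period_root :
  [/\ (0 < cf_period r)%N, iter (cf_period r) step principal = principal &
      forall k, (0 < k < cf_period r)%N -> iter k step principal <> principal].
Proof.
have [L L0 eq_L] := iter_step_periodic _ (reduced_principal m_gt0).
have [|/eventual_period_root[l0 eq_l] min_l] := @min_periodP _ (cf_digit r).
  by exists L; apply/eventual_period_root.
split=> // k /andP[k0]; rewrite ltnNge => /negP k_lt eq_k; apply: k_lt.
by apply: min_l; apply/eventual_period_root.
Qed.

End CompleteQuotients.

End ReducedStates.

(** * Sums of two squares and Legendre symbols *)

Lemma dvdz_addX_odd (a b : int) (j : nat) : (a + b %| a ^+ j.*2.+1 + b ^+ j.*2.+1)%Z.
Proof.
elim: j => [|j IHj]; first by rewrite !expr1.
have -> : a ^+ j.+1.*2.+1 + b ^+ j.+1.*2.+1 =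
    a ^+ 2 * (a ^+ j.*2.+1 + b ^+ j.*2.+1) - b ^+ j.*2.+1 * (a - b) * (a + b).
  by rewrite doubleS !exprS; ring.
by apply: rpredB; [apply: dvdz_mull | apply: dvdz_mull].
Qed.

Lemma fermat_littlez (p a : nat) : prime p -> (p %| a%:Z ^+ p - a%:Z)%Z.
Proof.
move=> p_pr; rewrite -eqz_mod_dvd -!natz -natrX !natz !modz_nat.
by rewrite fermat_little.
Qed.

Lemma prime_dvdzM (p : nat) (a b : int) : prime p ->
  (p %| a * b)%Z = (p %| a)%Z || (p %| b)%Z.
Proof. by move=> p_pr; rewrite !dvdzE abszM Euclid_dvdM. Qed.

Lemma prime_dvdz_sqr (p : nat) (a : int) : prime p ->
  (p %| a ^+ 2)%Z = (p %| a)%Z.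
Proof. by move=> p_pr; rewrite expr2 prime_dvdzM // orbb. Qed.

(* With [p = 2 (2 k + 1) + 1], the sum [a ^ 2 + b ^ 2] divides [a ^ p * b + a * b ^ p], which is
   [2 a b] modulo [p] by Fermat. *)
Lemma dvdz_sum_sqr (p : nat) (a b : int) : prime p -> p = 3 %[mod 4] ->
  (p %| a ^+ 2 + b ^+ 2)%Z -> (p %| a)%Z && (p %| b)%Z.
Proof.
move=> p_pr p3.
wlog [a0 b0] : a b / 0 <= a /\ 0 <= b.
  move=> H p_dvd; have := H `|a| `|b|.
  rewrite !normr_ge0 !real_normK ?num_real // => /(_ (conj isT isT) p_dvd).
  by rewrite !dvdzE !absz_id.
case: a b a0 b0 => // a [] // b _ _ p_dvd.
pose k := (p %/ 4)%N; have pE : p = k.*2.+1.*2.+1 by lia.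
have dvd_sum : (p %| a%:Z ^+ p * b%:Z + a%:Z * b%:Z ^+ p)%Z.
  have -> : a%:Z ^+ p * b%:Z + a%:Z * b%:Z ^+ p =
      a%:Z * b%:Z * ((a%:Z ^+ 2) ^+ k.*2.+1 + (b%:Z ^+ 2) ^+ k.*2.+1).
    by rewrite -!exprM mul2n {1 2}pE [_ ^+ _.*2.+1]exprS [b%:Z ^+ _.*2.+1]exprS; ring.
  by apply/dvdz_mull/(dvdz_trans p_dvd)/dvdz_addX_odd.
have : (p %| 2 * (a%:Z * b%:Z))%Z.
  have -> : 2 * (a%:Z * b%:Z) = (a%:Z ^+ p * b%:Z + a%:Z * b%:Z ^+ p)
      - ((a%:Z ^+ p - a%:Z) * b%:Z + a%:Z * (b%:Z ^+ p - b%:Z)) by ring.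
  apply: rpredB => //; apply: rpredD.
  - by apply/dvdz_mulr/fermat_littlez.
  - by apply/dvdz_mull/fermat_littlez.
have /negPf p2 : ~~ (p %| 2)%Z by rewrite dvdzE /= dvdn_prime2 //; lia.
rewrite !prime_dvdzM // p2 /= => /orP[] p_dvd1; move: p_dvd; rewrite p_dvd1.
- by rewrite rpredDl ?prime_dvdz_sqr.
- by rewrite rpredDr ?prime_dvdz_sqr // => ->.
Qed.

Lemma legendre_square (a z : int) (p : nat) : (0 < p)%N -> ~~ (p %| a)%Z ->
  (p %| z ^+ 2 - a)%Z -> legendre a p = 1.
Proof.
move=> p0 /negPf pa p_dvd; rewrite /legendre pa; case: ifP => // /negbT/existsP[].
have z0 : 0 <= (z %% p)%Z by rewrite modz_ge0; lia.
have zp : (`|(z %% p)%Z| < p)%N by have := @ltz_pmod z p; lia.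
exists (Ordinal zp); rewrite /= gez0_abs //.
by rewrite -eqz_mod_dvd in p_dvd; rewrite modzXm.
Qed.

(** If [a = x ^ 2] modulo [p], then [p] divides [(x y) ^ 2 + 1 ^ 2], hence 1 by [dvdz_sum_sqr]. *)
Lemma legendre_nonsquare (a y : int) (p : nat) : prime p -> p = 3 %[mod 4] ->
  (p %| a * y ^+ 2 + 1)%Z -> legendre a p = -1.
Proof.
move=> p_pr p3 p_dvd; have p1 : ~~ (p %| 1)%Z.
  by rewrite dvdz1 /= gtn_eqF ?prime_gt1.
rewrite /legendre; case: ifP => [pa|_].
  by move: p_dvd; rewrite rpredDl ?(negPf p1) // dvdz_mulr.
case: ifP => // /existsP[x]; rewrite eqz_mod_dvd => p_dvdx.
have : (p %| (x%:Z * y) ^+ 2 + 1 ^+ 2)%Z.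
  have -> : (x%:Z * y) ^+ 2 + 1 ^+ 2 = (x%:Z ^+ 2 - a) * y ^+ 2 + (a * y ^+ 2 + 1) by ring.
  by rewrite rpredDl // dvdz_mulr.
by case/(dvdz_sum_sqr _ _ _ p_pr p3)/andP=> _; rewrite (negPf p1).
Qed.

(** As [p] divides [x], cancelling it gives [q y ^ 2 = - (-1) ^ k] modulo [p]. For odd [k] this
    makes [q] the square of [q y]; for even [k] it makes [q] a nonresidue, since -1 is one. *)
Lemma legendre_norm (p q k : nat) (x y : int) : prime p -> prime q -> p <> q ->
  p = 3 %[mod 4] -> x ^+ 2 - (p * q)%:Z * y ^+ 2 = (-1) ^+ k * p%:Z ->
  legendre q p = - (-1) ^+ k.
Proof.
move=> p_pr q_pr neq_pq p3 eq_x.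
have p0 : p%:Z != 0 by have := prime_gt0 p_pr; lia.
have /dvdzP[x' xE] : (p %| x)%Z.
  rewrite -prime_dvdz_sqr // -[x ^+ 2](subrK ((p * q)%:Z * y ^+ 2)) eq_x PoszM.
  by apply: rpredD; [apply: dvdz_mull | rewrite -mulrA; apply: dvdz_mulr].
have eq_x' : q%:Z * y ^+ 2 + (-1) ^+ k = x' ^+ 2 * p%:Z.
  by apply: (mulfI p0); move: eq_x; rewrite xE PoszM; lia.
have p_dvd : (p %| q%:Z * y ^+ 2 + (-1) ^+ k)%Z by rewrite eq_x' dvdz_mull.
rewrite -signr_odd in p_dvd *; case: (odd k) p_dvd => p_dvd /=; rewrite ?expr0 ?expr1 ?opprK.
- apply: (legendre_square _ (q%:Z * y)); first exact: prime_gt0.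
    by rewrite dvdzE /= dvdn_prime2 //; apply/eqP.
  have -> : (q%:Z * y) ^+ 2 - q%:Z = q%:Z * (q%:Z * y ^+ 2 + (-1) ^+ true) by ring.
  exact: dvdz_mull.
- exact: (legendre_nonsquare _ y).
Qed.

(** The divisors are [1], [p], [q] and [p q]; the size bound excludes the last two. *)
Lemma dvdn_pq_small (p q d : nat) : prime p -> prime q -> (p < q)%N ->
  (d %| p * q)%N -> (1 < d)%N -> (d * d < p * q)%N -> d = p.
Proof.
move=> p_pr q_pr lt_pq d_dvd d1 d_small.
have p0 := prime_gt0 p_pr.
have [/dvdnP[e dE]|p_d] := boolP (p %| d)%N.
  move: d_dvd; rewrite dE mulnC dvdn_pmul2l // => /(proj2 (primeP q_pr)) /= /orP[]/eqP eE.
    by rewrite eE muln1.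
  by move: d_small; rewrite dE eE; nia.
move: d_dvd; rewrite Gauss_dvdr; last by rewrite coprime_sym prime_coprime.
by case/(proj2 (primeP q_pr))/orP=> /eqP dE; move: d1 d_small; rewrite dE; nia.
Qed.

Lemma pq_neq_sqr (p q : nat) (c : int) : prime p -> prime q -> p <> q ->
  c ^+ 2 <> (p * q)%:Z.
Proof.
move=> p_pr q_pr neq_pq eq_c; have p0 := prime_gt0 p_pr.
have : (p %| c)%Z by rewrite -prime_dvdz_sqr // eq_c dvdzE /= dvdn_mulr.
case/dvdzP=> d cE; have : q%:Z = d ^+ 2 * p%:Z.
  have p0z : p%:Z != 0 by lia.
  by apply: (mulfI p0z); rewrite -PoszM -eq_c cE; ring.
move=> qE; have : (p %| q%:Z)%Z by rewrite qE dvdz_mull.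
by rewrite dvdzE /= dvdn_prime2 // => /eqP.
Qed.

Lemma pq_neq_sum_sqr (p q : nat) (a b : int) : prime p -> prime q -> p <> q ->
  p = 3 %[mod 4] -> (p * q)%:Z <> a ^+ 2 + b ^+ 2.
Proof.
move=> p_pr q_pr neq_pq p3 eq_ab; have p0 := prime_gt0 p_pr.
have : (p %| a ^+ 2 + b ^+ 2)%Z by rewrite -eq_ab dvdzE /= dvdn_mulr.
case/(dvdz_sum_sqr _ _ _ p_pr p3)/andP=> /dvdzP[a' aE] /dvdzP[b' bE].
have p0z : p%:Z != 0 by lia.
have qE : q%:Z = (a' ^+ 2 + b' ^+ 2) * p%:Z.
  by apply: (mulfI p0z); rewrite -PoszM eq_ab aE bE; ring.
have : (p %| q%:Z)%Z by rewrite qE dvdz_mull.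
by rewrite dvdzE /= dvdn_prime2 // => /eqP.
Qed.

(* An even [Q] is either divisible by 4, and then so is [n], or it is 2 modulo 4, which
   [x ^ 2 - y ^ 2] never is. *)
Lemma norm_divisor_odd (n P Q Q' a x y e : int) : (n = 1 %[mod 4])%Z ->
  n - P ^+ 2 = Q' * Q -> 2 * P = a * Q -> x ^+ 2 - n * y ^+ 2 = e * Q ->
  e ^+ 2 = 1 -> (Q = 1 %[mod 2])%Z.
Proof.
move=> n1 nE aE eq_xy e1.
have [[Q2 QE]|//] : (exists Q2, Q = 2 * Q2) \/ (Q = 1 %[mod 2])%Z.
  by case: (boolP (Q %% 2 == 0)%Z) => ?; [left; exists (Q %/ 2)%Z; lia | right; lia].
have [t nt] : exists t, n = 4 * t + 1 by exists (n %/ 4)%Z; lia.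
have PE : P = a * Q2 by rewrite QE in aE; lia.
have half z : exists h (b : bool), z = 2 * h + b%:Z.
  by exists (z %/ 2)%Z, (z %% 2 != 0)%Z; lia.
have [v [b Q2E]] := half Q2.
case: b Q2E => /= Q2E; last first.
  suff : n = 4 * (a ^+ 2 * v ^+ 2 + Q' * v) by lia.
  by have -> : n = Q' * Q + P ^+ 2 by [rewrite -nE subrK]; rewrite PE QE Q2E; ring.
have [x1 [bx xE]] := half x; have [y1 [by1 yE]] := half y.
have e_unit : e = 1 \/ e = -1 by nia.
(* A square is its parity modulo 4 and [n = 1], so [bx - by1] is [e * Q = 2 e (2 v + 1)] modulo 4,
   impossible for a value in [[-1, 1]]. *)
suff : exists w, (bx%:Z - by1%:Z) = 2 * e + 4 * w.
  by case=> w; case: bx {xE} => /=; case: by1 {yE} => /=; case: e_unit; lia.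
exists (e * v - x1 ^+ 2 - x1 * bx%:Z + y1 ^+ 2 + y1 * by1%:Z + t * y ^+ 2).
have sqr_bool (b : bool) : b%:Z = b%:Z ^+ 2 by case: b.
rewrite [bx%:Z in LHS]sqr_bool [by1%:Z in LHS]sqr_bool.
have bxE : bx%:Z = x - 2 * x1 by lia.
have byE : by1%:Z = y - 2 * y1 by lia.
rewrite bxE byE; move: eq_xy; rewrite nt QE Q2E => /eqP; rewrite -subr_eq0 => /eqP eq_xy.
apply/eqP; rewrite -subr_eq0 -[X in _ == X]eq_xy; apply/eqP; ring.
Qed.

(** * The period modulo 4 and the Legendre symbol *)

Theorem corollary3p15 (R : realType) (p q : nat)
  (hp : prime p) (hq : prime q) (hpq : (p < q)%N)
  (hp3 : p = 3 %[mod 4]) (hq3 : q = 3 %[mod 4]) :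
  ((cf_period (Num.sqrt ((p * q)%:R : R)))%:Z = 1 + legendre q%:Z p %[mod 4])%Z.
Proof.
have neq_pq : p <> q by lia.
set r := Num.sqrt _; pose n : int := (p * q)%:Z; pose m := Num.floor r.
have p2 := prime_gt1 hp; have q2 := prime_gt1 hq.
have r0 : 0 <= r by exact: sqrtr_ge0.
have r_sqr : r ^+ 2 = n%:~R by rewrite sqr_sqrtr ?ler0n // /n pmulrn.
have m0 : 0 < m.
  rewrite gtz0_ge1 /m floor_ge_int /= -(@ler_pXn2r _ 2) ?nnegrE // r_sqr expr1n ler1z /n; nia.
have n_bounds : m ^+ 2 < n < (m + 1) ^+ 2.
  rewrite lt_neqAle; apply/andP; split; first (apply/andP; split).
  - by apply/eqP/pq_neq_sqr.
  - rewrite -(ler_int R) -r_sqr rmorphXn /= ler_pXn2r ?nnegrE ?ler0z ?(ltW m0) //.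
    exact: floor_le.
  - rewrite -(ltr_int R) -r_sqr rmorphXn /= ltr_pXn2r ?nnegrE ?ler0z //; last by lia.
    exact: floorD1_gt.
have [l0 eq_l min_l] := cf_period_root n m n_bounds R r r0 r_sqr m0.
move: (cf_period r) l0 eq_l min_l => l l0 eq_l min_l.
have [k lE] : exists k, l = (k + k)%N.
  case: (boolP (odd l)) => odd_l; last by exists l./2; lia.
  have lE : l = (l./2 + l./2.+1)%N by lia.
  rewrite lE in eq_l; have [P [Q]] := odd_period n m n_bounds _ m0 eq_l.
  by move/pq_neq_sum_sqr; case.
rewrite lE in eq_l min_l l0 *.
have neq_k : iter k (step n m) (principal m) <> principal m by apply: min_l; lia.
have [P [Q [Q' [a [x [y [[P0 PM Q1] [nE aE eq_xy]]]]]]]] :=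
  even_period n m n_bounds k m0 eq_l neq_k.
have Q_odd : (Q = 1 %[mod 2])%Z.
  apply: (norm_divisor_odd n P Q Q' a x y ((-1) ^+ k)) => //; last by rewrite sqrr_sign.
  by rewrite /n !modz_nat -modnMm hp3 hq3.
have /dvdzP[b bE] : (2 %| a)%Z.
  have : (2 %| a * Q)%Z by rewrite -aE dvdz_mulr.
  by rewrite (prime_dvdzM 2) // => /orP[//|]; lia.
have PE : P = b * Q by rewrite bE in aE; lia.
have QE : Q = p%:Z.
  (* [Q] divides [P = b * Q], hence [n], and [Q <= P <= m] gives [Q ^ 2 < n]. *)
  have Qn : n = (Q' + b * P) * Q by have -> : n = Q' * Q + P ^+ 2 by [lia]; rewrite PE; ring.
  have QP : Q <= P by rewrite PE ler_peMl; lia.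
  have Qs : Q * Q < n.
    by case/andP: n_bounds => mn _; apply: le_lt_trans mn; apply: ler_pM; lia.
  have : `|Q|%N = p; last by lia.
  apply: (dvdn_pq_small p q) => //; [|lia|].
    by have : (Q %| n)%Z by [rewrite Qn dvdz_mull]; rewrite dvdzE.
  by rewrite -ltz_nat PoszM gez0_abs //; lia.
rewrite QE in eq_xy.
(* The period [2 k] and [1 - (-1) ^ k] are both 0 modulo 4 for even [k] and both 2 for odd [k]. *)
rewrite (legendre_norm p q k x y) // -signr_odd; by case: (odd k) (odd_double_half k) => /=; lia.
Qed.
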